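(* Let $\{q_n\}\subset(0,\infty)$ satisfy $q_n-1=O(\frac1n)$, and consider $N^{(n)}_k$ under the measure $\mathcal{P}_n^{(q_n)}$. As $n\to\infty$: (i) For fixed $k\in\mathbb{N}$, $\frac{N^{(n)}_k}{\log n}$ converges in distribution to $1$; (ii) For integers $k_n\in[n]$ with $k_n=\Theta(n^\alpha)$, where $\alpha\in(0,1)$, $\frac{N^{(n)}_{k_n}}{\log n}$ converges in distribution to $1-\alpha$; (iii) For integers $k_n\in[n]$ with $k_n\sim dn$, $d\in(0,1)$, and $q_n=1+\frac cn$, $c\in\mathbb{R}$, $N^{(n)}_{k_n}$ converges in distribution to the Poisson distribution with parameter $\lambda_c$ given by $$\lambda_c=\begin{cases}e^{cd}\log\frac{1-e^{-c}}{1-e^{-cd}},&\text{if } c>0;\\[3pt] e^{cd}\log\frac{e^{-c}-1}{e^{-cd}-1},&\text{if } c<0;\\[3pt] -\log d,&\text{if } c=0;\end{cases}$$ (iv) For integers $k_n\in[n]$ satisfying $n-k_n=o(n)$, $N^{(n)}_{k_n}$ converges in distribution to $0$.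
   Context: Write $[n]=\{1,\ldots,n\}$ and let $S_n$ be the set of permutations of $[n]$, written in one-line notation $\sigma=\sigma_1\cdots\sigma_n$; $\sigma^{-1}_k$ is the position of $k$ in $\sigma$. A parking function of length $n$ is a sequence $\pi=(\pi_1,\ldots,\pi_n)\in[n]^n$ with $|\{i:\pi_i\le j\}|\ge j$ for all $j\in[n]$; $PF_n$ is the set of these. The inversion statistic is $I_n(\sigma)=\sum_{1\le i<j\le n}1_{\sigma_j<\sigma_i}$. For $j\in[n]$ let $I_{n,<j}(\sigma)=\sum_{1\le i<j}1_{\sigma^{-1}_j<\sigma^{-1}_i}$ (the number of inversions of $\sigma$ involving $j$ and a number less than $j$) and $\tilde I_{n,<j}=I_{n,<j}+1$. For $q\in(0,\infty)$, the Mallows measure on $S_n$ is $P_n^{(q)}(\sigma)=q^{I_n(\sigma)}/K_n$, where $K_n=\sum_{\rho\in S_n}q^{I_n(\rho)}$ is the normalizing constant; $P_n$ denotes the uniform measure on $S_n$. The map $(\sigma,\tau)\mapsto(\tilde I_{n,<\tau_1}(\sigma),\ldots,\tilde I_{n,<\tau_n}(\sigma))$ sends $S_n\times S_n$ into $PF_n$, and $\mathcal{P}_n^{(q)}$ denotes the probability measure on $PF_n$ that is the image of $P_n^{(q)}\times P_n$ under this map. For $\pi\in PF_n$ and $k\in[n]$, $N^{(n)}_k(\pi)=|\{i\in[n]:\pi_i=k\}|$ is the number of times $k$ appears as an entry of $\pi$. The notation $a_n\sim b_n$ means $a_n/b_n\to1$; $a_n=\Theta(b_n)$ means $a_n/b_n$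 is bounded above and bounded away from $0$ for large $n$. In (iii) with $c<0$, $n$ is taken large enough that $1+\frac cn>0$. *)

(* Defs.v *)
From HB Require Import structures.
From mathcomp Require Import all_boot all_order all_algebra fingroup perm.
From mathcomp Require Import all_classical all_reals all_analysis.

Set Implicit Arguments.
Unset Strict Implicit.
Unset Printing Implicit Defensive.

Import Order.TTheory GRing.Theory Num.Theory.
Import numFieldNormedType.Exports.

Local Open Scope classical_set_scope.
Local Open Scope ring_scope.

(* The set [n] = {1, ..., n} of positions and letters of a permutation is
   represented by 'I_n: the ordinal i stands for i.+1.  Entries of parking
   functions are natural numbers and keep their values in {1, ..., n}. *)

Definition inversions n (s : 'S_n) : nat :=
  \sum_(i < n) \sum_(j < n | (i < j)%N) (s j < s i)%N.

Definition inversions_below n (s : 'S_n) (j : 'I_n) : nat :=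
  \sum_(i < n | (i < j)%N) ((s^-1)%g j < (s^-1)%g i)%N.

Definition is_parking n (p : {ffun 'I_n -> nat}) : bool :=
  [forall i, (1 <= p i <= n)%N] &&
  [forall j : 'I_n, (j.+1 <= #|[set i | (p i <= j.+1)%N]%SET|)%N].

Record parking_function n := ParkingFunction {
  parking_val :> {ffun 'I_n -> nat};
  _ : is_parking parking_val }.

HB.instance Definition _ n := [isSub for @parking_val n].
HB.instance Definition _ n := [Choice of parking_function n by <:].

Definition parking_map_val n (st : 'S_n * 'S_n) : {ffun 'I_n -> nat} :=
  [ffun i => (inversions_below st.1 (st.2 i)).+1].

Lemma card_ord_lt n m : (m <= n)%N -> #|[set i : 'I_n | (i < m)%N]%SET| = m.
Proof.
move=> mn; rewrite -sum1dep_card -(big_ord_widen _ (fun=> 1%N) mn).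
by rewrite sum1_card card_ord.
Qed.

Lemma inversions_below_le n (s : 'S_n) (j : 'I_n) :
  (inversions_below s j <= j)%N.
Proof.
rewrite /inversions_below (@leq_trans (\sum_(i < n | (i < j)%N) 1)%N) //.
  by apply: leq_sum => i _; case: (_ < _)%N.
by rewrite sum1dep_card card_ord_lt// ltnW.
Qed.

Lemma parking_map_subproof n (st : 'S_n * 'S_n) :
  is_parking (parking_map_val st).
Proof.
apply/andP; split; apply/forallP => j.
  by rewrite ffunE /= (leq_ltn_trans (inversions_below_le _ _)).
rewrite -[X in (X <= _)%N](card_ord_lt (ltn_ord j)).
rewrite -(card_imset _ (@perm_inj _ (st.2^-1)%g)).
apply/subset_leq_card/fintype.subsetP => _ /imsetP[i + ->].
rewrite !inE ffunE permKV !ltnS => ij.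
exact: leq_trans (inversions_below_le _ _) ij.
Qed.

Definition parking_map n (st : 'S_n * 'S_n) : parking_function n :=
  ParkingFunction (parking_map_subproof st).

HB.instance Definition _ (T : finType) :=
  isPointed.Build (perm_type T) (1%g : {perm T}).
HB.instance Definition _ (T : finType) :=
  @isMeasurable.Build default_measure_display (perm_type T) discrete_measurable
  discrete_measurable0 discrete_measurableC discrete_measurableU.

HB.instance Definition _ n :=
  isPointed.Build (parking_function n) (parking_map (1, 1)%g).
HB.instance Definition _ n := @isMeasurable.Build default_measure_display
  (parking_function n) discrete_measurable discrete_measurable0
  discrete_measurableC discrete_measurableU.

Lemma measurable_parking_map n : measurable_fun setT (@parking_map n).
Proof.
move=> _ Y _; apply: countable_measurable; last first.
  apply: finite_set_countable.
  exact: (@finite_finset ('S_n * 'S_n)%type).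
move=> [s t]; have -> : [set (s, t)] = [set s] `*` [set t].
  by apply/seteqP; split => [_ -> //|[a b] /= [-> ->]].
exact: measurableX.
Qed.

HB.instance Definition _ n :=
  isMeasurableFun.Build _ _ _ _ (@parking_map n) (@measurable_parking_map n).

Section perm_measure.
Context {R : realType} {n : nat}.
Local Open Scope ereal_scope.

Definition perm_measure (w : 'S_n -> {nonneg R}) : set 'S_n -> \bar R :=
  fun A => \sum_(s : 'S_n) mscale (w s) \d_s A.

Variable w : 'S_n -> {nonneg R}.

Let perm_measure0 : perm_measure w set0 = 0.
Proof. by rewrite /perm_measure big1. Qed.

Let perm_measure_ge0 A : 0 <= perm_measure w A.
Proof. by rewrite /perm_measure; apply: sume_ge0. Qed.

Let perm_measure_sigma_additive : semi_sigma_additive (perm_measure w).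
Proof.
move=> F mF tF mUF; rewrite [X in _ --> X](_ : _ =
    lim ((fun n => \sum_(0 <= i < n) perm_measure w (F i)) @ \oo)).
  by apply: is_cvg_ereal_nneg_natsum => k _; exact: sume_ge0.
rewrite nneseries_sum//; apply: eq_bigr => /= i _.
exact: measure_semi_bigcup.
Qed.

HB.instance Definition _ := isMeasure.Build _ _ _ (perm_measure w)
  perm_measure0 perm_measure_ge0 perm_measure_sigma_additive.

Lemma perm_measure_setT :
  perm_measure w [set: 'S_n] = (\sum_(s : 'S_n) (w s)%:num)%R%:E.
Proof.
rewrite /perm_measure -sumEFin; apply: eq_bigr => s _.
by rewrite /mscale /= diracT mule1.
Qed.

End perm_measure.

Section mallows.
Context {R : realType}.
Variables (q : {posnum R}) (n : nat).

Definition mallows_const : R := \sum_(r : 'S_n) q%:num ^+ inversions r.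

Definition mallows_pmf (s : 'S_n) : R := q%:num ^+ inversions s / mallows_const.

Lemma mallows_const_gt0 : 0 < mallows_const.
Proof.
rewrite /mallows_const (bigD1 1%g) //= ltr_pwDl //.
by apply: sumr_ge0 => r _.
Qed.

Lemma mallows_pmf_ge0 s : 0 <= mallows_pmf s.
Proof. by rewrite divr_ge0 // ltW // mallows_const_gt0. Qed.

Definition mallows : set 'S_n -> \bar R :=
  perm_measure (fun s => NngNum (mallows_pmf_ge0 s)).

HB.instance Definition _ := Measure.on mallows.

Let mallows_setT : mallows [set: 'S_n] = 1%E.
Proof.
rewrite /mallows perm_measure_setT /= -mulr_suml divff //.
by rewrite gt_eqF // mallows_const_gt0.
Qed.

HB.instance Definition _ :=
  @Measure_isProbability.Build _ _ R mallows mallows_setT.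

End mallows.
Arguments mallows {R} q n _.

Section uniform_perm.
Context {R : realType}.
Variable n : nat.

Definition uniform_perm : set 'S_n -> \bar R :=
  perm_measure (fun=> (n`!%:R^-1 : R)%:nng).

HB.instance Definition _ := Measure.on uniform_perm.

Let uniform_perm_setT : uniform_perm [set: 'S_n] = 1%E.
Proof.
rewrite /uniform_perm perm_measure_setT /= sumr_const card_Sn.
by rewrite -mulr_natl divff // pnatr_eq0 -lt0n fact_gt0.
Qed.

HB.instance Definition _ :=
  @Measure_isProbability.Build _ _ R uniform_perm uniform_perm_setT.

End uniform_perm.
Arguments uniform_perm {R} n _.

(* The product sigma-algebra on pairs of permutations is again discrete, so
   parking_map is a random variable on the product space. *)
Definition parking_mallows {R : realType} (q : {posnum R}) (n : nat) :
    probability (parking_function n) R :=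
  distribution (mallows q n \x uniform_perm n)%E (@parking_map n).

Definition occurrences {R : realType} (n k : nat) (p : parking_function n) : R :=
  #|[set i : 'I_n | p i == k]%SET|%:R.

HB.instance Definition _ (R : realType) n k :=
  @isMeasurableFun.Build _ _ _ _ (@occurrences R n k) (fun _ Y _ => I).

Definition nat_to_real {R : realType} (k : nat) : R := k%:R.

HB.instance Definition _ (R : realType) :=
  @isMeasurableFun.Build _ _ _ _ (@nat_to_real R) (fun _ Y _ => I).

(* Convergence in distribution of real random variables, each living on its
   own probability space, to a random variable with law mu: convergence of the
   distribution functions at every continuity point of the limit. *)
Definition cvg_in_distribution {R : realType}
    (d : nat -> measure_display) (T : forall n, measurableType (d n))
    (P : forall n, probability (T n) R) (X : forall n, {RV (P n) >-> R})
    (mu : probability R R) : Prop :=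
  forall x : R, {for x, continuous (fun t : R => mu `]-oo, t]%classic)} ->
    cdf (X n) x @[n --> \oo] --> mu `]-oo, x]%classic.

(* The Poisson distribution seen on the real line.  The library's poisson_prob
   has a second argument that it does not use. *)
Definition poisson_law {R : realType} (rate : R) : probability R R :=
  distribution (poisson_prob rate 0) nat_to_real.

Definition poisson_rate {R : realType} (c d : R) : R :=
  if 0 < c then expR (c * d) * ln ((1 - expR (- c)) / (1 - expR (- (c * d))))
  else if c < 0 then
    expR (c * d) * ln ((expR (- c) - 1) / (expR (- (c * d)) - 1))
  else - ln d.

(* Main.v *)
(* N_k counts the j such that I_{<j} = k - 1.  Under the Mallows measure the I_{<j}
   are independent truncated geometric variables (Lehmer code), so N_k is a sum of
   independent Bernoulli variables of parameters q^(k-1) / [j]_q for k <= j <= n,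
   where [j]_q = 1 + q + ... + q^(j-1).
   With a_j = log([j]_q / q^j) one has 1 / [j+1]_q <= a_{j+1} - a_j <= 1 / (q [j]_q),
   which for every q at once gives the mean of N_k as q^(k-1) (a_n - a_k) up to a
   negligible error.  Parts (i) and (ii) follow from Chebyshev's inequality, (iii)
   from Le Cam's Poisson approximation and (iv) from Markov's inequality. *)

Require Import Defs.
From mathcomp Require Import all_boot all_order all_algebra fingroup perm.
From mathcomp Require Import all_classical all_reals all_analysis.
From mathcomp Require Import ring lra.

Set Implicit Arguments.
Unset Strict Implicit.
Unset Printing Implicit Defensive.

Import Order.TTheory GRing.Theory Num.Theory.
Import numFieldNormedType.Exports.

Local Open Scope classical_set_scope.
Local Open Scope ring_scope.

(** * Lehmer code *)

(** Independence of the Lehmer code is never stated for random variables. It enters as a polynomial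
    identity: the weighted sum of ['X^N] over all permutations is a product of linear factors
    [(1 - p j) + p j X]. Derivatives at 1 give the mean and the variance, coefficients give the
    point masses, and all four parts draw on this one identity. The function a_j comes from [j+1]_q
    = 1 + q [j]_q, which turns its increment into log (1 + 1 / (q [j]_q)). Telescoping it avoids
    Riemann sums for 1 / [j]_q, yields the logarithms of (iii) in closed form, and needs no
    distinction between q below, at or above 1. The hypothesis on q_n is used as a bound on n |log
    q_n|, which keeps all powers of q_n up to the n-th between two positive constants. *)

Lemma sum_inversions_below n (s : 'S_n) :
  (\sum_(j < n) inversions_below s j)%N = inversions s.
Proof.
rewrite /inversions /inversions_below (reindex_inj (@perm_inj _ s)) /=.
apply: eq_bigr => p _; rewrite (reindex_inj (@perm_inj _ s)) /=.
rewrite big_mkcond [RHS]big_mkcond /=; apply: eq_bigr => r _.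
by rewrite !permK; case: (s r < s p)%N; case: (p < r)%N.
Qed.

(** Insert the letters in increasing order. The letters below [j] that stand to the right of [j]
    form a final segment in the left-to-right order of the letters below [j]. Final segments of a
    total order are nested, so their size determines them, and with them the place of [j]. *)
Lemma inversions_below_inj n :
  injective (fun s : 'S_n => [ffun j => inversions_below s j]).
Proof.
move=> s t /ffunP st; apply: invg_inj.
pose u := (s^-1)%g; pose v := (t^-1)%g; rewrite -/u -/v.
have asymm (w : 'S_n) (i j : 'I_n) : i != j -> (w i < w j)%N = ~~ (w j < w i)%N.
  by move=> ij; rewrite -leqNgt ltn_neqAle val_eqE (inj_eq (@perm_inj _ w)) ij.
have uv m (i j : 'I_n) : (i < m)%N -> (j < m)%N -> (u i < u j)%N = (v i < v j)%N.
  elim: m i j => // m IH.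
  have key (i j : 'I_n) : (i < m)%N -> j = m :> nat -> (u j < u i)%N = (v j < v i)%N.
    move=> im jm.
    pose above (w : 'S_n) := [set i : 'I_n | (i < j)%N & (w j < w i)%N]%SET.
    have nest (w w' : 'S_n) : (forall i j : 'I_n, (i < m)%N -> (j < m)%N ->
        (w i < w j)%N = (w' i < w' j)%N) ->
        ~~ (above w \subset above w') -> above w' \subset above w.
      move=> ww' /fintype.subsetPn[a]; rewrite !inE => /andP[aj wja].
      rewrite aj /= -asymm ?neq_ltn ?aj // => w'aj.
      apply/fintype.subsetP => b; rewrite !inE => /andP[bj w'jb]; rewrite bj /=.
      rewrite (ltn_trans wja) // ww' -?jm //.
      exact: ltn_trans w'aj w'jb.
    have cardE : #|above u| = #|above v|.
      have := st j; rewrite !ffunE /inversions_below.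
      rewrite -!big_mkcondr /= !sum1dep_card.
      by [].
    have /eqP eq_above : above u == above v.
      have [sub|/(nest u v IH) sub] := boolP (above u \subset above v).
        by rewrite eqEcard sub cardE leqnn.
      by rewrite eq_sym eqEcard sub cardE leqnn.
    by have /setP /(_ i) := eq_above; rewrite !inE jm im.
  move=> i j; rewrite !ltnS leq_eqVlt => /orP[/eqP im|im];
    rewrite leq_eqVlt => /orP[/eqP jm|jm].
  - have -> : i = j by apply: val_inj; rewrite /= im jm.
    by rewrite !ltnn.
  - by rewrite key.
  - have ij : i != j by apply: contraTneq im => ->; rewrite jm ltnn.
    by rewrite asymm // [RHS]asymm // key.
  - exact: IH.
(* Each value is the number of smaller values, so the comparisons alone recover the permutation. *)
have rank (w : 'S_n) i : #|[set k | (w k < w i)%N]%SET| = w i.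
  rewrite -[RHS](card_ord_lt (ltnW (ltn_ord (w i)))).
  rewrite -[RHS](card_preimset _ (@perm_inj _ w)).
  by apply: eq_card => k; rewrite !inE.
apply/permP => i; apply: val_inj; rewrite /= -[LHS]rank -[RHS]rank.
by apply: eq_card => k; rewrite !inE; apply: (uv n).
Qed.

(* The Lehmer code is injective into a set of the same size n!, hence a
   bijection onto the product of the intervals [0, j]. *)
Lemma sum_perm_inversions_below (R : comNzRingType) n (F : 'I_n -> nat -> R) :
  \sum_(s : 'S_n) \prod_(j < n) F j (inversions_below s j) =
  \prod_(j < n) \sum_(x < j.+1) F j x.
Proof.
have bnd (s : 'S_n) (j : 'I_n) : (inversions_below s j < n)%N.
  exact: leq_ltn_trans (inversions_below_le _ _) (ltn_ord j).
pose code (s : 'S_n) : {ffun 'I_n -> 'I_n} := [ffun j => Ordinal (bnd s j)].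
have code_inj : injective code.
  move=> s t /ffunP st; apply: inversions_below_inj; apply/ffunP => j.
  by have := congr1 val (st j); rewrite !ffunE.
pose T (j : 'I_n) : pred 'I_n := [pred x : 'I_n | (x <= j)%N].
have imE : code @: [set: 'S_n]%SET =i family T.
  apply/subset_cardP.
    rewrite card_imset // cardsT card_Sn card_family.
    rewrite foldrE big_map big_enum /= fact_prod big_add1 /= big_mkord.
    apply: eq_bigr => j _; rewrite -[LHS](card_ord_lt (ltn_ord j)).
    by apply: eq_card => x; rewrite !inE.
  apply/fintype.subsetP => _ /imsetP[s _ ->]; apply/familyP => j.
  by rewrite ffunE !inE /= inversions_below_le.
under [RHS]eq_bigr => j _.
  rewrite (big_ord_widen n (F j)) ?ltn_ord // (eq_bigl (T j)) //.
  over.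
rewrite bigA_distr_big_dep /= -(eq_bigl _ _ imE) big_imset /=; last first.
  by move=> s t _ _; apply: code_inj.
rewrite (eq_bigl predT); last by move=> s; rewrite !inE.
by apply: eq_bigr => s _; apply: eq_bigr => j _; rewrite ffunE.
Qed.

(** * Sums of independent Bernoulli variables *)

Section bernoulli_sum.
Variables (R : realType) (p : nat -> R).
Implicit Types (n m : nat).

(** The probability generating function of a sum of independent Bernoulli variables. The hypothesis
    [gen] below says that [N] has this law under the weights [w], without any product space. *)
Definition bernoulli_gen n : {poly R} := \prod_(j < n) ((1 - p j)%:P + p j *: 'X).

Lemma bernoulli_genS n :
  bernoulli_gen n.+1 = bernoulli_gen n * ((1 - p n)%:P + p n *: 'X).
Proof. by rewrite /bernoulli_gen big_ord_recr. Qed.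

Lemma bernoulli_gen1 n : (bernoulli_gen n).[1] = 1.
Proof.
elim: n => [|n IH]; first by rewrite /bernoulli_gen big_ord0 hornerC.
by rewrite bernoulli_genS !hornerE IH /=; ring.
Qed.

Lemma bernoulli_gen_deriv1 n : (bernoulli_gen n)^`().[1] = \sum_(j < n) p j.
Proof.
elim: n => [|n IH]; first by rewrite /bernoulli_gen !big_ord0 derivC hornerC.
rewrite bernoulli_genS derivM derivD derivC derivZ derivX !hornerE IH.
by rewrite bernoulli_gen1 big_ord_recr /=; ring.
Qed.

Lemma bernoulli_gen_deriv2 n : (bernoulli_gen n)^`()^`().[1] =
  (\sum_(j < n) p j) ^+ 2 - \sum_(j < n) p j ^+ 2.
Proof.
elim: n => [|n IH].
  by rewrite /bernoulli_gen !big_ord0 !derivC hornerC; ring.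
rewrite bernoulli_genS !(derivM, derivD, derivC, derivZ, derivX) !hornerE IH.
by rewrite bernoulli_gen_deriv1 !big_ord_recr /= ?hornerE; ring.
Qed.

Lemma coef_bernoulli_genS n m : (bernoulli_gen n.+1)`_m =
  (1 - p n) * (bernoulli_gen n)`_m +
  p n * (if m is m'.+1 then (bernoulli_gen n)`_m' else 0).
Proof.
rewrite bernoulli_genS mulrDr coefD mulrC mul_polyC coefZ.
by rewrite -scalerAr coefZ coefMX; case: m.
Qed.

Section weighted_family.
Variables (I : finType) (w : I -> R) (N : I -> nat) (n : nat).
Hypothesis w_ge0 : forall i, 0 <= w i.
Hypothesis gen : \sum_i w i *: 'X^(N i) = bernoulli_gen n.

Lemma bernoulli_total : \sum_i w i = 1.
Proof.
rewrite -(bernoulli_gen1 n) -gen horner_sum; apply: eq_bigr => i _.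
by rewrite !hornerE expr1n mulr1.
Qed.

Lemma bernoulli_mean : \sum_i w i * (N i)%:R = \sum_(j < n) p j.
Proof.
rewrite -bernoulli_gen_deriv1 -gen (linear_sum (@deriv R)) horner_sum /=; apply: eq_bigr => i _.
by rewrite derivZ derivXn hornerZ hornerMn !hornerE expr1n.
Qed.

Lemma bernoulli_factorial_moment2 : \sum_i w i * ((N i)%:R * ((N i)%:R - 1)) =
  (\sum_(j < n) p j) ^+ 2 - \sum_(j < n) p j ^+ 2.
Proof.
rewrite -bernoulli_gen_deriv2 -gen !(linear_sum (@deriv R)) horner_sum /=; apply: eq_bigr => i _.
rewrite !derivZ derivXn derivMn derivXn hornerZ !hornerMn !hornerE expr1n.
case: (N i) => [|m] /=; first by rewrite mulr0n !(mulr0, mul0r).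
by rewrite -[m%:R *+ m.+1]mulr_natr -natr1; ring.
Qed.

(** Expanding the square in factorial moments shows that the variance is the mean minus the sum of
    the [p j ^+ 2]. *)
Lemma bernoulli_variance :
  \sum_i w i * ((N i)%:R - \sum_(j < n) p j) ^+ 2 <= \sum_(j < n) p j.
Proof.
set mu := \sum_(j < n) p j.
rewrite [leLHS](_ : _ = \sum_i w i * ((N i)%:R * ((N i)%:R - 1)) +
    (1 - 2 * mu) * \sum_i w i * (N i)%:R + mu ^+ 2 * \sum_i w i).
  rewrite bernoulli_total bernoulli_mean bernoulli_factorial_moment2 -/mu.
  rewrite [leLHS](_ : _ = mu - \sum_(j < n) p j ^+ 2); last by ring.
  by rewrite gerBl sumr_ge0 // => j _; rewrite sqr_ge0.
clearbody mu; rewrite !mulr_sumr -!big_split /=; apply: eq_bigr => i _; ring.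
Qed.

(** Deviations are taken from a target [a] instead of the mean. Half of [e] absorbs the distance
    between the two, which is where the factor 4 comes from. *)
Lemma bernoulli_chebyshev (a e : R) : 0 < e ->
    `|\sum_(j < n) p j - a| <= e / 2 ->
  \sum_(i | e <= `|(N i)%:R - a|) w i <= 4 * (\sum_(j < n) p j) / e ^+ 2.
Proof.
set mu := \sum_(j < n) p j => e0 mua.
have e2 : 0 < (e / 2) ^+ 2 by rewrite exprn_gt0 ?divr_gt0.
rewrite [leRHS](_ : _ = mu / (e / 2) ^+ 2); last by field; rewrite gt_eqF.
rewrite ler_pdivlMr // (le_trans _ bernoulli_variance) // mulr_suml.
rewrite big_mkcond /=; apply: ler_sum => i _.
case: ifPn => [far|_]; last by rewrite mulr_ge0 ?sqr_ge0.
apply: ler_wpM2l => //; rewrite -[leRHS]real_normK ?num_real //.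
rewrite lerXn2r ?nnegrE ?(ltW (divr_gt0 _ _)) //.
have := ler_distD mu (N i)%:R a; rewrite -/mu; lra.
Qed.

Lemma bernoulli_markov : \sum_(i | N i != 0%N) w i <= \sum_(j < n) p j.
Proof.
rewrite -bernoulli_mean big_mkcond /=; apply: ler_sum => i _.
case: ifPn => [Ni|_]; last by rewrite mulr_ge0.
by rewrite ler_peMr // ler1n lt0n.
Qed.

Lemma bernoulli_coef m : \sum_(i | N i == m) w i = (bernoulli_gen n)`_m.
Proof.
rewrite -gen coef_sum big_mkcond; apply: eq_bigr => i _.
by rewrite coefZ coefXn eq_sym; case: eqP; rewrite ?mulr1 ?mulr0.
Qed.

End weighted_family.

End bernoulli_sum.

(** * Poisson weights as functions of the rate, and Le Cam's inequality *)

Section poisson_weight.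
Variable R : realType.
Implicit Types (x y : R) (m : nat).

Definition poisson_weight m x : R := x ^+ m / m`!%:R * expR (- x).

(** The weight at [m - 1], with value 0 at [m = 0], so that the derivative in the rate is the
    previous weight minus the current one for every [m]. *)
Definition poisson_weight_pred m x : R :=
  if m is m'.+1 then poisson_weight m' x else 0.

Lemma poisson_weight_itv m x : 0 <= x -> 0 <= poisson_weight m x <= 1.
Proof.
move=> x0; rewrite /poisson_weight mulr_ge0 ?expR_ge0 ?divr_ge0 ?exprn_ge0 //=.
rewrite expRN ler_pdivrMr ?expR_gt0 // mul1r.
case: m => [|m]; first by rewrite expr0 divr1 (le_trans _ (expR_ge1Dx x)) ?lerDl.
by rewrite (le_trans _ (expR_ge1Dxn m x0)) // lerDr.
Qed.

Lemma poisson_weight_pred_itv m x : 0 <= x -> 0 <= poisson_weight_pred m x <= 1.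
Proof. by case: m => [|m] x0 /=; [rewrite lexx ler01 | exact: poisson_weight_itv]. Qed.

Lemma is_derive_poisson_weight m x :
  is_derive x 1 (poisson_weight m) (poisson_weight_pred m x - poisson_weight m x).
Proof.
have E : poisson_weight m = m`!%:R^-1 *: (id ^+ m * (expR \o -%R)).
  apply/funext => y; rewrite /poisson_weight.
  change (y ^+ m / m`!%:R * expR (- y) = m`!%:R^-1 * ((id ^+ m : R -> R) y * expR (- y))).
  by rewrite exprfctE /=; ring.
rewrite [X in is_derive _ _ X]E.
apply: is_derive_eq; case: m {E} => [|m] /=.
  by rewrite exprfctE /poisson_weight /GRing.scale /= !expr0 fact0; field.
rewrite /poisson_weight exprfctE /GRing.scale /= factS natrM exprS; field.
by rewrite nat1r !pnatr_eq0 -lt0n fact_gt0.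
Qed.

Lemma poisson_weight_mvt m x y : 0 <= x -> x <= y ->
  exists2 z, x <= z <= y & poisson_weight m y - poisson_weight m x =
    (poisson_weight_pred m z - poisson_weight m z) * (y - x).
Proof.
move=> x0 xy; have [||z] := @MVT_segment R (poisson_weight m)
    (fun z => poisson_weight_pred m z - poisson_weight m z) x y xy.
- by move=> z _; apply: is_derive_poisson_weight.
- apply: derivable_within_continuous => z _.
  by have [] := is_derive_poisson_weight m z.
- by rewrite in_itv /= => zxy ->; exists z.
Qed.

Lemma poisson_weight_lipschitz m x y : 0 <= x -> x <= y ->
  `|poisson_weight m y - poisson_weight m x| <= y - x.
Proof.
move=> x0 xy; have [z /andP[xz _] ->] := poisson_weight_mvt m x0 xy.
have z0 := le_trans x0 xz.
rewrite normrM (ger0_norm (_ : 0 <= y - x)) ?subr_ge0 // ler_piMl ?subr_ge0 //.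
have := poisson_weight_itv m z0; have := poisson_weight_pred_itv m z0.
by rewrite ler_norml; lra.
Qed.

(** The mean value point lies within [y] of [x], and the derivative is a difference of two
    1-Lipschitz functions, so moving it to [x] changes it by at most [2 * y]. *)
Lemma poisson_weight_taylor m x y : 0 <= x -> 0 <= y ->
  `|poisson_weight m (x + y) -
    ((1 - y) * poisson_weight m x + y * poisson_weight_pred m x)| <= 2 * y ^+ 2.
Proof.
move=> x0 y0; have xy : x <= x + y by rewrite lerDl.
have [z /andP[xz zy] E] := poisson_weight_mvt m x0 xy.
have L1 := poisson_weight_lipschitz m x0 xz.
have L2 : `|poisson_weight_pred m z - poisson_weight_pred m x| <= z - x.
  case: m {E L1} => [|m] /=; first by rewrite subrr normr0 subr_ge0.
  exact: poisson_weight_lipschitz.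
rewrite [X in `|X|](_ : _ = y * ((poisson_weight_pred m z - poisson_weight_pred m x) -
   (poisson_weight m z - poisson_weight m x))); last first.
  by move: E; rewrite (addrC x) addrK => /eqP; rewrite subr_eq => /eqP ->; ring.
rewrite normrM ger0_norm // [leRHS](_ : _ = y * (y + y)); last by ring.
rewrite ler_wpM2l // (le_trans (ler_normB _ _)) // lerD //; lra.
Qed.

(* Le Cam: the recursion of the coefficients under one more factor of parameter y
   is the first-order Taylor step of the Poisson weights, so each factor costs at
   most 2 y^2. *)
Lemma bernoulli_gen_poisson (p : nat -> R) n m : (forall j, 0 <= p j <= 1) ->
  `|(bernoulli_gen p n)`_m - poisson_weight m (\sum_(j < n) p j)| <=
  2 * \sum_(j < n) p j ^+ 2.
Proof.
move=> p01; elim: n m => [|n IH] m.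
  rewrite /bernoulli_gen !big_ord0 coefC /poisson_weight oppr0 expR0 mulr0.
  by case: m => [|m]; rewrite ?expr0 ?expr0n /= ?mul0r ?divr1 ?mulr1 subrr normr0.
rewrite coef_bernoulli_genS !big_ord_recr /=.
set mu := \sum_(j < n) p j; set s := \sum_(j < n) _.
have /andP[p0 p1] := p01 n.
have mu0 : 0 <= mu by apply: sumr_ge0 => j _; have /andP[] := p01 j.
have s0 : 0 <= s by apply: sumr_ge0 => j _; rewrite sqr_ge0.
set c := (bernoulli_gen p n)`_m; set c' := (if m is _.+1 then _ else _).
have h1 : `|c - poisson_weight m mu| <= 2 * s by exact: IH.
have h2 : `|c' - poisson_weight_pred m mu| <= 2 * s.
  by rewrite /c'; case: (m) => [|m'] /=; [rewrite subrr normr0 mulr_ge0 | exact: IH].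
have h3 := poisson_weight_taylor m mu0 p0.
(* The two inherited errors form a convex combination and are not amplified; only the Taylor error
   is new. *)
rewrite [X in `|X|](_ : _ = (1 - p n) * (c - poisson_weight m mu) +
  p n * (c' - poisson_weight_pred m mu) - (poisson_weight m (mu + p n) -
    ((1 - p n) * poisson_weight m mu + p n * poisson_weight_pred m mu))); last by ring.
rewrite (le_trans (ler_normB _ _)) // [leRHS]mulrDr lerD //.
rewrite (le_trans (ler_normD _ _)) // !normrM (ger0_norm p0) ger0_norm ?subr_ge0 //.
rewrite [leRHS](_ : _ = (1 - p n) * (2 * s) + p n * (2 * s)); last by ring.
by rewrite lerD // ler_wpM2l // subr_ge0.
Qed.

End poisson_weight.

(** * The law of N_k *)

Section mallows_law.
Context {R : realType}.
Implicit Types (q : R) (k n m : nat).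

(** The sum form, unlike the quotient by [q - 1], covers [q = 1]. *)
Definition qint q m : R := \sum_(x < m) q ^+ x.

(* Indices are shifted by one: k stands for the letter k.+1 of a parking function
   and m for the number m.+1 of [n]. *)
Definition success_prob q k m : R :=
  if (k <= m)%N then q ^+ k / qint q m.+1 else 0.

Definition level_size n (s : 'S_n) k : nat :=
  #|[set j | inversions_below s j == k]%SET|.

Lemma qint_gt0 q m : 0 < q -> 0 < qint q m.+1.
Proof.
move=> q0; rewrite /qint big_ord_recl expr0 ltr_pwDl //.
by apply: sumr_ge0 => i _; rewrite exprn_ge0 // ltW.
Qed.

Lemma success_prob_itv q k m : 0 < q -> 0 <= success_prob q k m <= 1.
Proof.
move=> q0; rewrite /success_prob; case: ifP => km; last by rewrite lexx ler01.
have h := qint_gt0 m q0.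
apply/andP; split; first by rewrite divr_ge0 ?exprn_ge0 // ltW.
rewrite ler_pdivrMr // mul1r.
rewrite /qint (bigD1 (Ordinal (km : (k < m.+1)%N))) //= lerDl.
by apply: sumr_ge0 => i _; rewrite exprn_ge0 // ltW.
Qed.

Lemma mallows_constE (q : {posnum R}) n :
  mallows_const q n = \prod_(j < n) qint q%:num j.+1.
Proof.
rewrite /mallows_const -(sum_perm_inversions_below (fun _ x => q%:num ^+ x)).
apply: eq_bigr => s _; rewrite -sum_inversions_below.
by rewrite prodrXr.
Qed.

(** The left side is the generating function of the event that a geometric variable truncated to
    [0, m] equals [k]. Writing X^b as 1 + b (X - 1) for b in {0, 1} isolates the term [x = k], which
    is missing when [k > m]. *)
Lemma qint_level_gen q k m : 0 < q ->
  (qint q m.+1)^-1 *: (\sum_(x < m.+1) q ^+ x *: 'X^(x == k :> nat)) =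
  (1 - success_prob q k m)%:P + success_prob q k m *: 'X.
Proof.
move=> q0; have /gt_eqF/negbT qn0 := qint_gt0 m q0.
have E (x : 'I_m.+1) : q ^+ x *: 'X^(x == k :> nat) =
    (q ^+ x)%:P + (if x == k :> nat then q ^+ x *: ('X - 1) else 0).
  by case: eqP => _; rewrite ?expr1 ?expr0 ?addr0 -?mul_polyC; ring.
rewrite (eq_bigr _ (fun x _ => E x)) big_split /= -rmorph_sum /= -/(qint q m.+1).
rewrite -big_mkcond /= scalerDr -[_ *: _%:P]mul_polyC -polyCM mulVf //.
have -> : \sum_(x < m.+1 | x == k :> nat) q ^+ x *: ('X - 1) =
    (if (k <= m)%N then q ^+ k *: ('X - 1 : {poly R}) else 0).
  by rewrite (big_ord1_eq _ (fun x => q ^+ x *: ('X - 1))).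
rewrite /success_prob; case: ifP => _; last by rewrite scaler0 scale0r subr0.
by rewrite scalerA mulrC -!mul_polyC polyCB; ring.
Qed.

(** Both [q ^+ inversions s] and ['X^(level_size s k)] are products over the entries of the Lehmer
    code, so the sum over permutations factors. *)
Lemma mallows_level_size_gen (q : {posnum R}) n k :
  \sum_(s : 'S_n) mallows_pmf q s *: 'X^(level_size s k) =
  bernoulli_gen (success_prob q%:num k) n.
Proof.
pose F (j : 'I_n) x : {poly R} := (q%:num ^+ x) *: 'X^(x == k).
have E (s : 'S_n) : mallows_pmf q s *: 'X^(level_size s k) =
    (mallows_const q n)^-1 *: \prod_(j < n) F j (inversions_below s j).
  rewrite /F scaler_prod !prodrXr sum_inversions_below scalerA mulrC.
  by rewrite /level_size -sum1dep_card big_mkcond.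
rewrite (eq_bigr _ (fun s _ => E s)).
rewrite -scaler_sumr sum_perm_inversions_below mallows_constE -prodfV -scaler_prod.
rewrite /bernoulli_gen; apply: eq_bigr => j _.
exact: qint_level_gen.
Qed.

Lemma mallowsE (q : {posnum R}) n (A : set 'S_n) :
  mallows q n A = (\sum_(s | s \in A) mallows_pmf q s)%:E.
Proof.
rewrite /mallows /perm_measure -sumEFin [RHS]big_mkcond /=; apply: eq_bigr => s _.
by rewrite /mscale /= diracE; case: (s \in A); rewrite ?mule1 ?mule0.
Qed.

(** The second permutation only reorders the entries, so it disappears from the count. *)
Lemma occurrences_parking_map n k (s t : 'S_n) :
  occurrences k.+1 (parking_map (s, t)) = (level_size s k)%:R :> R.
Proof.
rewrite /occurrences /level_size; congr _%:R.
by rewrite -[RHS](card_preimset _ (@perm_inj _ t)); apply: eq_card => i; rewrite !inE /= ffunE eqSS.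
Qed.

Lemma parking_mallowsE (q : {posnum R}) n k (U : set R) :
  parking_mallows q n (@occurrences R n k.+1 @^-1` U) =
  (\sum_(s : 'S_n | (level_size s k)%:R \in U) mallows_pmf q s)%:E.
Proof.
rewrite /parking_mallows /distribution /pushforward /=.
rewrite [X in (_ \x _)%E X](_ : _ =
    [set s | U (level_size s k)%:R] `*` [set: 'S_n]).
  rewrite product_measure1E // [X in (_ * X)%E]probability_setT mule1.
  exact: mallowsE.
apply/seteqP; split => -[s t] /=; rewrite occurrences_parking_map //.
by case.
Qed.

End mallows_law.

(** * Bounds on the mean *)

Section mean_bounds.
Context {R : realType}.
Implicit Types (q x : R) (k m n : nat).

Lemma ler_ln_subr1 x : 0 < x -> ln x <= x - 1.
Proof. by move=> x0; rewrite -{1}(subrK 1 x) addrC le_ln1Dx // ltrBrDr addNr. Qed.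

Lemma qintS q m : qint q m.+1 = 1 + q * qint q m.
Proof.
rewrite /qint big_ord_recl expr0 mulr_sumr; congr (_ + _).
by apply: eq_bigr => i _; rewrite -exprS.
Qed.

(* By lnqint_step, it acts as a discrete primitive of 1 / qint q m for q close
   to 1; it equals ln m when q = 1. *)
Definition lnqint q m : R := ln (qint q m / q ^+ m).

(** The increment is [ln x] with x = 1 + 1 / (q [m+1]_q), and the two bounds are 1 - 1/x <= ln x <=
    x - 1. *)
Lemma lnqint_step q m : 0 < q ->
  (qint q m.+2)^-1 <= lnqint q m.+2 - lnqint q m.+1 <= (q * qint q m.+1)^-1.
Proof.
move=> q0; set a := qint q m.+1.
have a0 : 0 < a by exact: qint_gt0.
have b0 : 0 < 1 + q * a by rewrite addr_gt0 // mulr_gt0.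
have qa0 : 0 < q * a by rewrite mulr_gt0.
rewrite /lnqint qintS -/a -ln_div ?posrE ?divr_gt0 ?exprn_gt0 //.
set x := (X in ln X); have xE : x = 1 + (q * a)^-1.
  by rewrite /x (exprS _ m.+1); field; rewrite ?mulf_neq0 ?gt_eqF ?exprn_gt0.
have x0 : 0 < x by rewrite xE addr_gt0 // invr_gt0.
apply/andP; split; last first.
  by rewrite (le_trans (ler_ln_subr1 x0)) // xE addrAC subrr add0r.
rewrite -lerN2 -lnV ?posrE // (le_trans (ler_ln_subr1 _)) ?invr_gt0 //.
by rewrite xE le_eqVlt; apply/orP; left; apply/eqP; field; rewrite !gt_eqF.
Qed.

Lemma lnqint_homo q m n : 0 < q -> (m <= n)%N -> lnqint q m.+1 <= lnqint q n.+1.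
Proof.
move=> q0; elim: n => [|n IH]; first by rewrite leqn0 => /eqP ->.
rewrite leq_eqVlt => /orP[/eqP -> //|]; rewrite ltnS => /IH /le_trans; apply.
have /andP[h _] := lnqint_step n q0; rewrite -subr_ge0 (le_trans _ h) //.
by rewrite invr_ge0 ltW // qint_gt0.
Qed.

Lemma sum_success_prob q k n :
  \sum_(j < n) success_prob q k j = q ^+ k * \sum_(k <= j < n) (qint q j.+1)^-1.
Proof.
rewrite /success_prob -big_mkcond mulr_sumr /=.
by rewrite [RHS](big_nat_widenl k 0) // big_mkord.
Qed.

Lemma sum_success_prob_ge q k n : 0 < q -> (k < n)%N ->
  q ^+ k.+1 * (lnqint q n - lnqint q k.+1) <= \sum_(j < n) success_prob q k j.
Proof.
move=> q0 kn; rewrite sum_success_prob exprSr -mulrA ler_wpM2l ?exprn_ge0 ?(ltW q0) //.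
(* The upper half of [lnqint_step] costs one factor [q] and telescopes up to [n.+1]; monotonicity
   lowers this to [n], the index that also occurs in the upper bound. *)
apply: (@le_trans _ _ (q * (lnqint q n.+1 - lnqint q k.+1))).
  rewrite ler_wpM2l ?(ltW q0) // lerB //.
  by case: n kn => // n _; apply: lnqint_homo.
rewrite -(telescope_sumr (fun j => lnqint q j.+1)) 1?ltnW // mulr_sumr.
apply: ler_sum => j _; have /andP[_ h] := lnqint_step j q0.
by rewrite mulrC -ler_pdivlMr // -invfM mulrC.
Qed.

Lemma sum_success_prob_le q k n : 0 < q -> (k < n)%N ->
  \sum_(j < n) success_prob q k j <=
  q ^+ k * ((qint q k.+1)^-1 + (lnqint q n - lnqint q k.+1)).
Proof.
move=> q0 kn; rewrite sum_success_prob ler_wpM2l ?exprn_ge0 ?(ltW q0) //.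
(* The lower half of [lnqint_step] bounds the reciprocal at the larger index, so the term [j = k]
   has no increment to pay for it and stays apart. *)
rewrite big_ltn // lerD2l; case: n kn => // n kn.
rewrite big_add1 /= -(telescope_sumr (fun j => lnqint q j.+1)) //.
by apply: ler_sum => j _; have /andP[] := lnqint_step j q0.
Qed.

Section near_one.
Variables (q B : R) (n : nat).
Hypotheses (q0 : 0 < q) (qB : n%:R * `|ln q| <= B).

Lemma expr_near1_itv m : (m <= n)%N -> expR (- B) <= q ^+ m <= expR B.
Proof.
move=> mn; have : `|m%:R * ln q| <= B.
  by rewrite normrM ger0_norm // (le_trans _ qB) // ler_wpM2r // ler_nat.
by rewrite ler_norml -[q in q ^+ m]lnK ?posrE // -expRM_natl !ler_expR.
Qed.

Lemma qint_near1_itv m : (m <= n)%N ->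
  m%:R * expR (- B) <= qint q m <= m%:R * expR B.
Proof.
have const (c : R) : m%:R * c = \sum_(i < m) c.
  by rewrite sumr_const card_ord mulr_natl.
move=> mn; rewrite !const.
have bnd (i : 'I_m) := expr_near1_itv (leq_trans (ltnW (ltn_ord i)) mn).
by apply/andP; split; apply: ler_sum => i _; have /andP[] := bnd i.
Qed.

(** One [B] comes from comparing [m]_q with m, the other from [q ^+ m]. *)
Lemma lnqint_near1 m : (0 < m <= n)%N -> `|lnqint q m - ln m%:R| <= 2 * B.
Proof.
case: m => // m /= mn.
have /andP[l1 u1] := expr_near1_itv mn; have /andP[l2 u2] := qint_near1_itv mn.
have a0 := qint_gt0 m q0; have qm0 : 0 < q ^+ m.+1 by rewrite exprn_gt0.
rewrite /lnqint ln_div ?posrE // ler_norml.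
have lnM1 (x : R) : ln (m.+1%:R * expR x) = ln m.+1%:R + x.
  by rewrite lnM ?posrE ?expR_gt0 // expRK.
have := l1; rewrite -ler_ln ?posrE ?expR_gt0 // expRK => {}l1.
have := u1; rewrite -ler_ln ?posrE ?expR_gt0 // expRK => {}u1.
have := l2; rewrite -ler_ln ?posrE ?mulr_gt0 ?expR_gt0 // lnM1 => {}l2.
have := u2; rewrite -ler_ln ?posrE ?mulr_gt0 ?expR_gt0 // lnM1 => {}u2.
by apply/andP; split; lra.
Qed.

(** Numerator and denominator contribute one [B] each. The bound is uniform in [j], which serves
    both for the mean in (iv) and for the Le Cam error in (iii). *)
Lemma success_prob_near1 k j : (j < n)%N ->
  success_prob q k j <= expR (2 * B) / k.+1%:R.
Proof.
move=> jn; rewrite /success_prob; case: ifP => kj; last first.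
  by rewrite divr_ge0 ?expR_ge0.
have kn : (k < n)%N := leq_ltn_trans kj jn.
have /andP[_ u1] := expr_near1_itv (ltnW kn); have /andP[l2 _] := qint_near1_itv jn.
have jB : 0 < j.+1%:R * expR (- B) by rewrite mulr_gt0 ?expR_gt0.
rewrite (le_trans (ler_pM _ _ u1 (_ : _ <= (j.+1%:R * expR (- B))^-1))) //.
- by rewrite exprn_ge0 // ltW.
- by rewrite invr_ge0 ltW // qint_gt0.
- by rewrite lef_pV2 ?posrE // qint_gt0.
rewrite invfM expRN invrK (_ : 2 * B = B + B); last by ring.
rewrite expRD mulrCA [leRHS]mulrC ler_wpM2r ?mulr_ge0 ?expR_ge0 //.
by rewrite lef_pV2 ?posrE // ler_nat.
Qed.

Lemma sum_success_prob_near1 k : (k < n)%N ->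
  \sum_(j < n) success_prob q k j <= (n - k)%:R * (expR (2 * B) / k.+1%:R).
Proof.
move=> kn; rewrite mulr_natl -sumr_const_nat (big_nat_widenl k 0) // big_mkord.
rewrite [leRHS]big_mkcond /=; apply: ler_sum => j _.
by case: ifPn => kj; rewrite ?success_prob_near1 // /success_prob (negPf kj).
Qed.

End near_one.

(** The lower side uses - ln q = ln (1/q) <= (1 - q) / q; the factor 2 bounds 1/q. *)
Lemma ln_near1 q : `|q - 1| <= 2^-1 -> `|ln q| <= 2 * `|q - 1|.
Proof.
move=> h; have q0 : 2^-1 <= q by move: h; rewrite ler_norml; lra.
have q1 : 0 < q by lra.
have := ler_ln_subr1 q1; have := ler_ln_subr1 (_ : 0 < q^-1).
rewrite lnV ?posrE // invr_gt0 => /(_ q1) l u.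
have l' : (1 - q) / q <= 2 * `|q - 1|.
  rewrite ler_pdivrMr // distrC; have := ler_norm (1 - q).
  have := normr_ge0 (1 - q); nra.
rewrite ler_norml; apply/andP; split.
  by move: l'; rewrite mulrBl mulfV ?gt_eqF // mul1r; lra.
by have := ler_norm (q - 1); have := normr_ge0 (q - 1); lra.
Qed.

End mean_bounds.

(** * Convergence in distribution *)

Section convergence_in_distribution.
Context {R : realType}.

Lemma dirac_ray (a x : R) : \d_a `]-oo, x]%classic = ((a <= x)%R%:R)%:E :> \bar R.
Proof.
rewrite diracE; congr (_%:R%:E); rewrite -[RHS]/(nat_of_bool _); congr nat_of_bool.
by apply/idP/idP; rewrite inE /= in_itv.
Qed.

Lemma dirac_ray_discontinuous (a : R) :
  ~ {for a, continuous (fun t : R => \d_a `]-oo, t]%classic : \bar R)}.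
Proof.
move=> cont; have lim_a : a - harmonic n @[n --> \oo] --> a.
  by rewrite -[X in _ --> X]subr0; apply: cvgB; [exact: cvg_cst|exact: cvg_harmonic].
have := cvg_comp _ _ lim_a cont.
rewrite /comp dirac_ray lexx.
under eq_fun do rewrite dirac_ray leNgt gtrBl harmonic_gt0 /=.
by move=> /(cvg_unique _ (cvg_cst _)) => /(_ (@ereal_hausdorff R)) /eqP; rewrite eqe eq_sym oner_eq0.
Qed.

(** Convergence in probability suffices. For [x < a] the ray lies in a far set, for [x > a] it
    contains the complement of one, and [x = a] is not a continuity point of the limit. *)
Lemma cvg_in_distribution_dirac (d : nat -> measure_display)
    (T : forall n, measurableType (d n)) (P : forall n, probability (T n) R)
    (X : forall n, {RV (P n) >-> R}) (a : R) :
  (forall e : R, 0 < e ->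
    P n (X n @^-1` [set y | e <= `|y - a|]) @[n --> \oo] --> 0%E) ->
  cvg_in_distribution X (\d_a : probability R R).
Proof.
move=> far x cont; rewrite [X in _ --> X](dirac_ray a x).
have mX n U : measurable U -> measurable (X n @^-1` U).
  by move=> mU; apply: measurable_funPTI.
have mray n : measurable (X n @^-1` `]-oo, x]) by apply: mX; exact: measurable_itv.
have mfar n (e : R) : measurable (X n @^-1` [set y | e <= `|y - a|]).
  apply: mX; rewrite [X in measurable X](_ : _ = `]-oo, a - e] `|` `[a + e, +oo[).
    by apply: measurableU; exact: measurable_itv.
  apply/seteqP; split => y /=; rewrite !in_itv /= andbT.
    by rewrite ler_normr => /orP[] h; [right|left]; lra.
  by rewrite ler_normr => -[] h; apply/orP; [right|left]; lra.
have [xa|ax|xa] := ltgtP x a.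
- have /far h : 0 < a - x by rewrite subr_gt0.
  apply: (squeeze_cvge _ (cvg_cst 0%E) h); apply: nearW => n.
  rewrite cdf_ge0 /=; change (P n (X n @^-1` `]-oo, x]) <= P n (X n @^-1` [set y | a - x <= `|y - a|]%R))%E.
  apply: le_measure; [by rewrite inE; exact: mray|by rewrite inE; exact: mfar|].
  move=> w /=; rewrite in_itv /= => Xx.
  by rewrite ler_normr; apply/orP; right; lra.
- have /far h : 0 < x - a by rewrite subr_gt0.
  have h1 : (1 - P n (X n @^-1` [set y | x - a <= `|y - a|]%R))%E @[n --> \oo] --> 1%E.
    rewrite -[X in _ --> X]sube0; apply: cvgeB => //; exact: cvg_cst.
  apply: (squeeze_cvge _ h1 (cvg_cst 1%E)); apply: nearW => n.
  rewrite cdf_le1 andbT -probability_setC //.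
  change (P n (~` (X n @^-1` [set y | x - a <= `|y - a|]%R)) <= P n (X n @^-1` `]-oo, x]))%E.
  apply: le_measure; [by rewrite inE; exact: measurableC|by rewrite inE; exact: mray|].
  move=> w /= /negP; rewrite -ltNge => Xx; rewrite /= in_itv /=.
  by have := ler_norm (X n w - a); lra.
- by exfalso; apply: (@dirac_ray_discontinuous a); rewrite -{1}xa.
Qed.

(** Reduces the distribution function of a counting variable to its first [M] point masses, with
    [M = 0] for negative [x]. *)
Lemma nat_ray (x : R) : exists M, forall m : nat, (m%:R <= x) = (m < M)%N.
Proof.
have [x0|x0] := leP 0 x; last first.
  by exists 0%N => m; rewrite ltn0 leNgt (lt_le_trans x0).
exists (Num.truncn x).+1 => m; rewrite ltnS.
by rewrite truncn_ge_nat.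
Qed.

Lemma poisson_law_ray (r x : R) M : 0 < r ->
    (forall m : nat, (m%:R <= x) = (m < M)%N) ->
  poisson_law r `]-oo, x]%classic = (\sum_(m < M) poisson_weight m r)%:E.
Proof.
move=> r0 xM; rewrite /poisson_law /distribution /pushforward /=.
rewrite [X in poisson_prob r 0 X](_ : _ = `I_M); last first.
  by apply/seteqP; split => m /=; rewrite in_itv /= /nat_to_real xM.
rewrite /poisson_prob r0 esum_fset //; last first.
  by move=> m _; rewrite lee_fin poisson_pmf_ge0.
rewrite -fsbig_ord -sumEFin; apply: eq_bigr => m _.
by rewrite /poisson_pmf r0 /poisson_weight.
Qed.

End convergence_in_distribution.

(** * Limits of the mean *)

Section limits.
Context {R : realType}.
Variables (q : nat -> R) (B : R) (k : nat -> nat).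
Hypothesis q0 : forall n, 0 < q n.
Hypothesis qB : \forall n \near \oo, n%:R * `|ln (q n)| <= B.
Hypothesis kn : \forall n \near \oo, (k n < n)%N.

Definition mean_level n : R := \sum_(j < n) success_prob (q n) (k n) j.

Lemma cvg_ln_natV : (ln n%:R : R)^-1 @[n --> \oo] --> (0 : R).
Proof.
apply/gtr0_cvgV0; first by near=> n; rewrite ln_gt0 // ltr1n; near: n; exact: nbhs_infty_gt.
apply/cvgryPge => A; near=> n.
rewrite -[A]expRK ler_ln ?posrE ?expR_gt0 //; last first.
  by rewrite ltr0n; near: n; exact: nbhs_infty_gt.
near: n; exact: nbhs_infty_ger.
Unshelve. all: by end_near. Qed.

Lemma cvg_expr_index (r : R) : n%:R * ln (q n) @[n --> \oo] --> r ->
  forall (m : nat -> nat) (d : R), (m n)%:R / n%:R @[n --> \oo] --> d ->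
  q n ^+ m n @[n --> \oo] --> expR (d * r).
Proof.
move=> qr m d md.
have : expR ((m n)%:R / n%:R * (n%:R * ln (q n))) @[n --> \oo] --> expR (d * r).
  by apply: continuous_cvg; [exact: continuous_expR|exact: cvgM].
apply: cvg_trans; apply: near_eq_cvg; near=> n.
have n0 : n%:R != 0 :> R by rewrite pnatr_eq0 -lt0n; near: n; exact: nbhs_infty_gt.
by rewrite mulrA divfK // expRM_natl lnK ?posrE.
Unshelve. all: by end_near. Qed.

(** Here [n%:R * ln (q n)] need not converge: it is bounded, and it is multiplied by a ratio tending
    to 0. *)
Lemma cvg_expr_index0 (m : nat -> nat) : (m n)%:R / n%:R @[n --> \oo] --> (0 : R) ->
  q n ^+ m n @[n --> \oo] --> (1 : R).
Proof.
move=> m0.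
have : expR ((m n)%:R / n%:R * (n%:R * ln (q n))) @[n --> \oo] --> expR (0 : R).
  apply: continuous_cvg; first exact: continuous_expR.
  apply/norm_cvg0P.
  have mB : (m n)%:R / n%:R * B @[n --> \oo] --> (0 : R).
    by rewrite -(mul0r B); apply: cvgM => //; exact: cvg_cst.
  apply: (squeeze_cvgr _ (cvg_cst 0) mB); near=> n.
  rewrite normr_ge0 normrM ger0_norm ?divr_ge0 // ler_wpM2l ?divr_ge0 //.
  by rewrite normrM ger0_norm //; near: n.
rewrite expR0; apply: cvg_trans; apply: near_eq_cvg; near=> n.
have n0 : n%:R != 0 :> R by rewrite pnatr_eq0 -lt0n; near: n; exact: nbhs_infty_gt.
by rewrite mulrA divfK // expRM_natl lnK ?posrE.
Unshelve. all: by end_near. Qed.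

Lemma near1_bound_ge0 : 0 <= B.
Proof.
near \oo => n; apply: (@le_trans _ _ (n%:R * `|ln (q n)|)); first by rewrite mulr_ge0.
by near: n.
Unshelve. all: by end_near. Qed.

Lemma mean_level_cvg0 : (n - k n)%:R / (k n).+1%:R @[n --> \oo] --> (0 : R) ->
  mean_level n @[n --> \oo] --> (0 : R).
Proof.
move=> h; have h' : (n - k n)%:R / (k n).+1%:R * expR (2 * B) @[n --> \oo] --> (0 : R).
  by rewrite -(mul0r (expR (2 * B))); apply: cvgM => //; exact: cvg_cst.
apply: (squeeze_cvgr _ (cvg_cst 0) h'); near=> n; apply/andP; split.
  by apply: sumr_ge0 => j _; have /andP[] := success_prob_itv (k n) j (q0 n).
have kn' : (k n < n)%N by near: n.
have qB' : n%:R * `|ln (q n)| <= B by near: n.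
by rewrite mulrAC -mulrA; exact: sum_success_prob_near1.
Unshelve. all: by end_near. Qed.

(** Allowing [alpha = 0] treats (i) and (ii) together. The hypothesis is the logarithmic form of k =
    Theta(n^alpha). *)
Lemma mean_level_cvg_log (alpha D : R) : 0 <= alpha < 1 ->
  (\forall n \near \oo, `|ln (k n).+1%:R - alpha * ln n%:R| <= D) ->
  (ln n%:R)^-1 * mean_level n @[n --> \oo] --> 1 - alpha.
Proof.
move=> /andP[alpha0 alpha1] kD; have B0 := near1_bound_ge0.
(* Comparing [lnqint] with [ln] at [n] and at [(k n).+1] costs [2 * B] each, comparing
   [ln (k n).+1%:R] with [alpha * ln n%:R] costs [D], and [expR B] bounds the isolated term of the
   upper bound on the mean. *)
pose E := 4 * B + D + expR B.
have cvgE : (ln n%:R)^-1 * E @[n --> \oo] --> (0 : R).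
  by rewrite -(mul0r E); apply: cvgM; [exact: cvg_ln_natV | exact: cvg_cst].
(* The ratio is at most exp (D - y) with y = (1 - alpha) ln n, and exp (- y) <= 1/y turns this into
   a multiple of 1 / ln n. It is needed for [q n ^+ k n] to tend to 1. *)
have k1n : (k n).+1%:R / n%:R @[n --> \oo] --> (0 : R).
  have cvgexp : expR (D + (alpha - 1) * ln n%:R) @[n --> \oo] --> (0 : R).
    have cvgL : (ln n%:R)^-1 * (expR D / (1 - alpha)) @[n --> \oo] --> (0 : R).
      rewrite -(mul0r (expR D / (1 - alpha))).
      by apply: cvgM; [exact: cvg_ln_natV | exact: cvg_cst].
    apply: (squeeze_cvgr _ (cvg_cst 0) cvgL); near=> n; rewrite expR_ge0 /=.
    have L0 : 0 < ln n%:R :> R.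
      by rewrite ln_gt0 // ltr1n; near: n; exact: nbhs_infty_gt.
    have y0 : 0 < (1 - alpha) * ln n%:R by rewrite mulr_gt0 // subr_gt0.
    rewrite -opprB mulNr expRD expRN mulrCA ler_wpM2l ?expR_ge0 // -invfM (mulrC (ln _)).
    rewrite lef_pV2 ?posrE ?expR_gt0 // (le_trans _ (expR_ge1Dx _)) //.
    by rewrite lerDr.
  apply: (squeeze_cvgr _ (cvg_cst 0) cvgexp); near=> n.
  have n0 : 0 < n%:R :> R by rewrite ltr0n; near: n; exact: nbhs_infty_gt.
  rewrite divr_ge0 //= -[(k n).+1%:R]lnK ?posrE // -[X in _ / X <= _]lnK ?posrE //.
  rewrite -expRN -expRD ler_expR.
  have : `|ln (k n).+1%:R - alpha * ln n%:R| <= D by near: n.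
  by rewrite ler_norml; lra.
have kn0 : (k n)%:R / n%:R @[n --> \oo] --> (0 : R).
  apply: (squeeze_cvgr _ (cvg_cst 0) k1n); near=> n.
  by rewrite divr_ge0 //= ler_wpM2r // ler_nat.
have low : q n ^+ (k n).+1 * ((1 - alpha) - (ln n%:R)^-1 * E) @[n --> \oo] --> 1 - alpha.
  rewrite -[X in _ --> X]mul1r; apply: cvgM; first exact: cvg_expr_index0.
  by rewrite -[X in _ --> X]subr0; apply: cvgB => //; exact: cvg_cst.
have high : q n ^+ k n * ((1 - alpha) + (ln n%:R)^-1 * E) @[n --> \oo] --> 1 - alpha.
  rewrite -[X in _ --> X]mul1r; apply: cvgM; first exact: cvg_expr_index0.
  by rewrite -[X in _ --> X]addr0; apply: cvgD => //; exact: cvg_cst.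
apply: (squeeze_cvgr _ low high); near=> n.
have kn' : (k n < n)%N by near: n.
have qB' : n%:R * `|ln (q n)| <= B by near: n.
have n0 : (0 < n)%N by exact: leq_ltn_trans kn'.
have L0 : 0 < ln n%:R :> R by rewrite ln_gt0 // ltr1n; near: n; exact: nbhs_infty_gt.
have kD' : `|ln (k n).+1%:R - alpha * ln n%:R| <= D by near: n.
have h1 : `|lnqint (q n) n - ln n%:R| <= 2 * B by apply: (lnqint_near1 (q0 n) qB'); rewrite n0 leqnn.
have h2 : `|lnqint (q n) (k n).+1 - ln (k n).+1%:R| <= 2 * B by apply: (lnqint_near1 (q0 n) qB').
have h3 : (qint (q n) (k n).+1)^-1 <= expR B.
  have /andP[h _] := qint_near1_itv (q0 n) qB' kn'.
  rewrite -[expR B]invrK lef_pV2 ?posrE ?qint_gt0 ?invr_gt0 ?expR_gt0 //.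
  by rewrite -expRN (le_trans _ h) // ler_peMl ?expR_ge0 // ler1n.
have eB := expR_ge0 B.
move: kD' h1 h2; rewrite !ler_norml => /andP[? ?] /andP[? ?] /andP[? ?].
have dE x : x - (ln n%:R)^-1 * E = (ln n%:R)^-1 * (x * ln n%:R - E).
  by field; rewrite gt_eqF.
have dE' x : x + (ln n%:R)^-1 * E = (ln n%:R)^-1 * (x * ln n%:R + E).
  by field; rewrite gt_eqF.
rewrite dE dE' mulrCA (mulrCA (_ ^+ k n)) !(ler_pM2l (_ : 0 < (ln n%:R)^-1)) ?invr_gt0 //.
apply/andP; split.
  apply: le_trans (sum_success_prob_ge (q0 n) kn').
  by rewrite ler_wpM2l ?exprn_ge0 ?(ltW (q0 n)) // mulrBl mul1r /E; lra.
apply: le_trans (sum_success_prob_le (q0 n) kn') _.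
by rewrite ler_wpM2l ?exprn_ge0 ?(ltW (q0 n)) // mulrBl mul1r /E; lra.
Unshelve. all: by end_near. Qed.

Lemma cvg_indexSV : ((k n)%:R : R) @[n --> \oo] --> +oo%R ->
  ((k n).+1%:R : R)^-1 @[n --> \oo] --> (0 : R).
Proof.
move=> /cvgryPge koo; apply/gtr0_cvgV0; first exact: nearW.
apply/cvgryPge => A; near=> n; rewrite (@le_trans _ _ (k n)%:R) ?ler_nat //.
by near: n; exact: koo.
Unshelve. all: by end_near. Qed.

(** The two bounds on the mean differ by a factor [q n], which tends to 1, and by the term 1 /
    [k+1]_q, which vanishes because [k n] tends to infinity. *)
Lemma mean_level_cvg_lnqint (f l : R) :
  q n @[n --> \oo] --> (1 : R) ->
  ((k n)%:R : R) @[n --> \oo] --> +oo%R ->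
  q n ^+ k n @[n --> \oo] --> f ->
  lnqint (q n) n - lnqint (q n) (k n).+1 @[n --> \oo] --> l ->
  mean_level n @[n --> \oo] --> f * l.
Proof.
move=> q1 koo kf al.
have qint0 : (qint (q n) (k n).+1)^-1 @[n --> \oo] --> (0 : R).
  have kB : (k n).+1%:R^-1 * expR B @[n --> \oo] --> (0 : R).
    by rewrite -(mul0r (expR B)); apply: cvgM; [exact: cvg_indexSV|exact: cvg_cst].
  apply: (squeeze_cvgr _ (cvg_cst 0) kB); near=> n.
  have kn' : (k n < n)%N by near: n.
  have qB' : n%:R * `|ln (q n)| <= B by near: n.
  have /andP[h _] := qint_near1_itv (q0 n) qB' kn'.
  rewrite invr_ge0 ltW ?qint_gt0 //= -[expR B]invrK -invfM lef_pV2 ?posrE ?qint_gt0 //.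
    by rewrite -expRN.
  by rewrite mulr_gt0 // invr_gt0 expR_gt0.
have low : q n * (q n ^+ k n) * (lnqint (q n) n - lnqint (q n) (k n).+1) @[n --> \oo] --> f * l.
  by rewrite -[f]mul1r; apply: cvgM => //; apply: cvgM.
have high : q n ^+ k n * ((qint (q n) (k n).+1)^-1 + (lnqint (q n) n - lnqint (q n) (k n).+1)) @[n --> \oo] --> f * l.
  by rewrite -[l in f * l]add0r; apply: cvgM => //; apply: cvgD.
apply: (squeeze_cvgr _ low high); near=> n.
have kn' : (k n < n)%N by near: n.
by rewrite -exprS sum_success_prob_ge ?sum_success_prob_le.
Unshelve. all: by end_near. Qed.

(** The sum of squares is at most the largest parameter, of order 1/k, times the mean. *)
Lemma sum_sqr_success_prob_cvg0 l :
  ((k n)%:R : R) @[n --> \oo] --> +oo%R ->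
  mean_level n @[n --> \oo] --> (l : R) ->
  \sum_(j < n) success_prob (q n) (k n) j ^+ 2 @[n --> \oo] --> (0 : R).
Proof.
move=> koo ml.
have h : (k n).+1%:R^-1 * expR (2 * B) * mean_level n @[n --> \oo] --> (0 : R).
  rewrite -(mul0r l); apply: cvgM => //; rewrite -(mul0r (expR (2 * B))).
  by apply: cvgM; [exact: cvg_indexSV|exact: cvg_cst].
apply: (squeeze_cvgr _ (cvg_cst 0) h); near=> n; apply/andP; split.
  by apply: sumr_ge0 => j _; rewrite sqr_ge0.
have qB' : n%:R * `|ln (q n)| <= B by near: n.
rewrite /mean_level mulr_sumr; apply: ler_sum => j _.
have /andP[p0 _] := success_prob_itv (k n) j (q0 n).
by rewrite expr2 ler_wpM2r // mulrC (success_prob_near1 (q0 n) qB').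
Unshelve. all: by end_near. Qed.

End limits.

(** * The window [q n = 1 + c / n%:R] with [k n] of order [n] *)

Section linear_scale.
Context {R : realType}.
Implicit Types (c d : R).

Lemma cvg_natV : (n%:R : R)^-1 @[n --> \oo] --> (0 : R).
Proof.
apply/gtr0_cvgV0; last exact: cvgr_idn.
by near=> n; rewrite ltr0n; near: n; exact: nbhs_infty_gt.
Unshelve. all: by end_near. Qed.

Lemma cvg_ratio_pred (k : nat -> nat) d : (forall n, (0 < n)%N -> (0 < k n)%N) ->
  (k n)%:R / n%:R @[n --> \oo] --> d ->
  (k n).-1%:R / n%:R @[n --> \oo] --> d.
Proof.
move=> k0 kd; have : (k n)%:R / n%:R - n%:R^-1 @[n --> \oo] --> d - 0.
  by apply: cvgB => //; exact: cvg_natV.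
rewrite subr0; apply: cvg_trans; apply: near_eq_cvg; near=> n.
have n0 : (0 < n)%N by near: n; exact: nbhs_infty_gt.
by rewrite -[in LHS](prednK (k0 n n0)) -natr1 mulrDl mul1r addrK.
Unshelve. all: by end_near. Qed.

(** Since [n]_q / q^n = (1 - q^-n) / (q - 1), the factor q - 1 cancels in the quotient, so both
    signs of [c] are treated at once. *)
Lemma lnqint_diff q m n : 0 < q -> q != 1 -> (0 < m)%N -> (0 < n)%N ->
  lnqint q n - lnqint q m =
  ln ((1 - (q ^+ n)^-1) / (1 - (q ^+ m)^-1)) :> R.
Proof.
case: m => // m; case: n => // n q0 q1 _ _.
have [qm qn] : 0 < qint q m.+1 /\ 0 < qint q n.+1 by split; exact: qint_gt0.
have Qm := exprn_gt0 m.+1 q0; have Qn := exprn_gt0 n.+1 q0.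
have qintE a : qint q a = (q ^+ a - 1) / (q - 1).
  by rewrite subrX1 [(q - 1) * _]mulrC mulfK // subr_eq0.
have m1 : q ^+ m.+1 - 1 != 0.
  by apply: contraTneq qm => h; rewrite qintE h mul0r ltxx.
rewrite /lnqint -ln_div ?posrE ?divr_gt0 // !qintE; congr ln; field.
by rewrite m1 subr_eq0 q1 (gt_eqF Qm) (gt_eqF Qn).
Qed.

Section window.
Variables (q : nat -> R) (k : nat -> nat) (c d : R).
Hypothesis q0 : forall n, 0 < q n.
Hypothesis q_near : \forall n \near \oo, q n = 1 + c / n%:R.
Hypothesis k0 : forall n, (0 < n)%N -> (0 < k n)%N.
Hypothesis d01 : 0 < d < 1.
Hypothesis kd : (k n)%:R / n%:R @[n --> \oo] --> d.

Lemma cvg_window_base : q n @[n --> \oo] --> (1 : R).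
Proof.
have : 1 + c / n%:R @[n --> \oo] --> 1 + c * 0.
  by apply: cvgD; [exact: cvg_cst|apply: cvgM; [exact: cvg_cst|exact: cvg_natV]].
rewrite mulr0 addr0; apply: cvg_trans; apply: near_eq_cvg.
by near=> n; apply/esym; near: n; exact: q_near.
Unshelve. all: by end_near. Qed.

(** Multiplied by n, the bounds 1 - 1/q <= ln q <= q - 1 become c/q and c, whatever the sign of
    [c]. *)
Lemma cvg_window_ln : n%:R * ln (q n) @[n --> \oo] --> c.
Proof.
have low : c / q n @[n --> \oo] --> c.
  rewrite -[X in _ --> X]divr1; apply: cvgM; first exact: cvg_cst.
  by apply: cvgV; [exact: oner_neq0|exact: cvg_window_base].
apply: (squeeze_cvgr _ low (cvg_cst c)); near=> n.
have n0 : 0 < n%:R :> R by rewrite ltr0n; near: n; exact: nbhs_infty_gt.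
have nq : n%:R * (q n - 1) = c.
  have -> : q n = 1 + c / n%:R by near: n.
  by field; rewrite gt_eqF.
rewrite -[X in _ <= _ <= X]nq ler_pM2l // ler_ln_subr1 // andbT.
have := @ler_ln_subr1 R (q n)^-1; rewrite invr_gt0 lnV ?posrE // => /(_ (q0 n)) h.
rewrite -nq -mulrA ler_pM2l //.
by rewrite mulrBl mulfV ?gt_eqF // mul1r; lra.
Unshelve. all: by end_near. Qed.

Let cvg_expr (m : nat -> nat) (a : R) : (m n)%:R / n%:R @[n --> \oo] --> a ->
  q n ^+ m n @[n --> \oo] --> expR (c * a).
Proof.
move=> ma; rewrite [c * a]mulrC.
exact: (cvg_expr_index q0 cvg_window_ln ma).
Qed.

Lemma cvg_window_expr : q n ^+ (k n).-1 @[n --> \oo] --> expR (c * d).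
Proof. by apply: cvg_expr; exact: cvg_ratio_pred. Qed.

(** For nonzero [c] the limits of q^n and q^k go into the closed form of [lnqint_diff]. At [c = 0]
    that form is 0/0, but then [q n = 1] eventually and [lnqint] is the plain logarithm. *)
Lemma cvg_window_lnqint : lnqint (q n) n - lnqint (q n) (k n) @[n --> \oo] -->
  (if c == 0 then - ln d else ln ((1 - expR (- c)) / (1 - expR (- (c * d))))).
Proof.
have /andP[d0 d1] := d01.
case: eqP => [c0|/eqP c0].
  have : - ln ((k n)%:R / n%:R) @[n --> \oo] --> - ln d.
    by apply: cvgN; apply: continuous_cvg => //; exact: continuous_ln.
  apply: cvg_trans; apply: near_eq_cvg; near=> n.
  have n0 : (0 < n)%N by near: n; exact: nbhs_infty_gt.
  have -> : q n = 1.
    by have -> : q n = 1 + c / n%:R; [near: n|rewrite c0 mul0r addr0].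
  have qint1 m : qint 1 m = m%:R :> R.
    by rewrite /qint (eq_bigr _ (fun i _ => expr1n _ _)) sumr_const card_ord.
  by rewrite /lnqint !expr1n !divr1 !qint1 ln_div ?posrE ?ltr0n ?k0 // opprB.
have nn1 : n%:R / n%:R @[n --> \oo] --> (1 : R).
  have : (1 : R) @[_ --> \oo] --> (1 : R) by exact: cvg_cst.
  apply: cvg_trans; apply: near_eq_cvg; near=> n.
  by rewrite divff // pnatr_eq0 -lt0n; near: n; exact: nbhs_infty_gt.
have one_minus (m : nat -> nat) a : (m n)%:R / n%:R @[n --> \oo] --> a ->
    1 - (q n ^+ m n)^-1 @[n --> \oo] --> 1 - expR (- (c * a)).
  move=> ma; rewrite expRN; apply: cvgB; first exact: cvg_cst.
  by apply: cvgV; [rewrite gt_eqF ?expR_gt0|exact: cvg_expr].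
have den0 a : 0 < a -> 1 - expR (- (c * a)) != 0.
  move=> a0; rewrite subr_eq0 eq_sym -expR0 (inj_eq (@expR_inj R)) oppr_eq0.
  by rewrite mulf_neq0 // gt_eqF.
have ratio : (1 - (q n ^+ n)^-1) / (1 - (q n ^+ k n)^-1) @[n --> \oo] -->
    (1 - expR (- c)) / (1 - expR (- (c * d))).
  apply: cvgM; first by rewrite -[c in expR (- c)]mulr1; exact: one_minus.
  by apply: cvgV; [exact: den0|exact: one_minus].
have : ln ((1 - (q n ^+ n)^-1) / (1 - (q n ^+ k n)^-1)) @[n --> \oo] -->
    ln ((1 - expR (- c)) / (1 - expR (- (c * d)))).
  apply: continuous_cvg => //; apply: continuous_ln.
  have [cpos|cneg|] := ltgtP 0 c; last by move=> /esym/eqP; rewrite (negPf c0).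
    by rewrite divr_gt0 // subr_gt0 expR_lt1 oppr_lt0 // mulr_gt0.
  by rewrite -[X in 0 < X]mulrNN -invrN divr_gt0 // opprB subr_gt0 expR_gt1 oppr_gt0 // pmulr_llt0.
apply: cvg_trans; apply: near_eq_cvg; near=> n.
have n0 : (0 < n)%N by near: n; exact: nbhs_infty_gt.
rewrite lnqint_diff ?k0 //.
have -> : q n = 1 + c / n%:R by near: n.
by rewrite -subr_eq0 addrAC subrr add0r mulf_neq0 // invr_eq0 pnatr_eq0 -lt0n.
Unshelve. all: by end_near. Qed.

Lemma cvg_window_index : ((k n).-1%:R : R) @[n --> \oo] --> +oo%R.
Proof.
have /andP[d0 _] := d01; apply/cvgryPge => A; near=> n.
have n0 : 0 < n%:R :> R by rewrite ltr0n; near: n; exact: nbhs_infty_gt.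
have : d / 2 <= (k n).-1%:R / n%:R.
  near: n; apply: (cvgr_ge _ (cvg_ratio_pred k0 kd)).
  by rewrite ltr_pdivrMr // mulr2n mulrDr mulr1 ltrDl.
rewrite ler_pdivlMr //; apply: le_trans.
rewrite mulrC -ler_pdivrMr ?divr_gt0 //.
near: n; exact: nbhs_infty_ger.
Unshelve. all: by end_near. Qed.

End window.

Lemma poisson_rateE c d : poisson_rate c d = expR (c * d) *
  (if c == 0 then - ln d else ln ((1 - expR (- c)) / (1 - expR (- (c * d))))).
Proof.
rewrite /poisson_rate; have [cneg|cpos|->] := ltgtP c 0 => //.
- by congr (_ * ln _); rewrite -[LHS]mulrNN -invrN !opprB.
- by rewrite mul0r expR0 mul1r.
Qed.

(** Needed because [poisson_prob] tests whether its rate is positive. As d < 1, the argument of the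
    logarithm exceeds 1 for either sign of [c]. *)
Lemma poisson_rate_gt0 c d : 0 < d < 1 -> 0 < poisson_rate c d.
Proof.
move=> /andP[d0 d1]; rewrite /poisson_rate.
have [cneg|cpos|_] := ltgtP c 0; last by rewrite oppr_gt0 ln_lt0 // d0.
- have cd0 : 0 < - (c * d) by rewrite oppr_gt0 pmulr_llt0.
  rewrite mulr_gt0 ?expR_gt0 // ln_gt0 // ltr_pdivlMr ?mul1r ?subr_gt0 ?expR_gt1 //.
  by rewrite ltrD2r ltr_expR ltrN2 ltr_nMr.
- have cd0 : - (c * d) < 0 by rewrite oppr_lt0 mulr_gt0.
  rewrite mulr_gt0 ?expR_gt0 // ln_gt0 // ltr_pdivlMr ?mul1r ?subr_gt0 ?expR_lt1 //.
  by rewrite ltrD2l ltrN2 ltr_expR ltrN2 gtr_pMr.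
Qed.

End linear_scale.

Lemma near1_ln_bound (R : realType) (q : nat -> R) :
  (fun n => q n - 1) =O_\oo (fun n => n%:R^-1 : R) ->
  exists B : R, \forall n \near \oo, n%:R * `|ln (q n)| <= B.
Proof.
move=> /eqO_exP[C C0 qC]; exists (2 * C); near=> n.
have n0 : 0 < n%:R :> R by rewrite ltr0n; near: n; exact: nbhs_infty_gt.
have : `|q n - 1| <= C * `|n%:R^-1| by near: n.
rewrite gtr0_norm ?invr_gt0 // => qn.
have Cn : C / n%:R <= 2^-1.
  rewrite ler_pdivrMr // mulrC -ler_pdivrMr ?invr_gt0 // invrK.
  near: n; exact: nbhs_infty_ger.
have lnq := ln_near1 (le_trans qn Cn).
rewrite mulrC -ler_pdivlMr // (le_trans lnq) // -mulrA ler_pM2l //.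
Unshelve. all: by end_near. Qed.

(** * Limit laws of the occurrences *)

Section parking_limits.
Context {R : realType}.
Variables (q : nat -> {posnum R}) (k : nat -> nat).
Hypothesis k_itv : \forall n \near \oo, (0 < k n <= n)%N.

Let p n := success_prob (q n)%:num (k n).-1.
Let mean := mean_level (fun n => (q n)%:num : R) (fun n => (k n).-1).

Let law n (U : set R) : (0 < k n)%N ->
  parking_mallows (q n) n (@occurrences R n (k n) @^-1` U) =
  (\sum_(s : 'S_n | (level_size s (k n).-1)%:R \in U) mallows_pmf (q n) s)%:E.
Proof. by move=> k0; rewrite -{1}(prednK k0) parking_mallowsE. Qed.

(** The variance is at most the mean, which is O(ln n), whereas deviations are measured on the scale
    ln n, so Chebyshev leaves a bound of order 1 / ln n. *)
Lemma parking_cvg_log (a : R) :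
  (ln n%:R)^-1 * mean n @[n --> \oo] --> a ->
  cvg_in_distribution (P := fun n => parking_mallows (q n) n)
    (fun n => (ln n%:R)^-1 *: (@occurrences R n (k n) : {mfun _ >-> R}))
    (\d_a : probability R R).
Proof.
move=> mean_a; apply: cvg_in_distribution_dirac => e e0.
have bound : (4 / e ^+ 2) * ((ln n%:R)^-1 * mean n) * (ln n%:R)^-1 @[n --> \oo] --> (0 : R).
  rewrite -(mulr0 (4 / e ^+ 2 * a)); apply: cvgM; last exact: cvg_ln_natV.
  by apply: cvgM => //; exact: cvg_cst.
have boundE : ((4 / e ^+ 2) * ((ln n%:R)^-1 * mean n) * (ln n%:R)^-1)%:E @[n --> \oo] --> 0%E.
  by apply: cvg_EFin => //; exact: nearW.
apply: (squeeze_cvge _ (cvg_cst 0%E) boundE); near=> n.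
have /andP[k0 _] : (0 < k n <= n)%N by near: n.
have L0 : 0 < ln n%:R :> R by rewrite ln_gt0 // ltr1n; near: n; exact: nbhs_infty_gt.
apply/andP; split; first exact: measure_ge0.
change (parking_mallows (q n) n (@occurrences R n (k n) @^-1`
  [set y : R | e <= `|(ln n%:R)^-1 * y - a|]%R) <=
  ((4 / e ^+ 2) * ((ln n%:R)^-1 * mean n) * (ln n%:R)^-1)%:E)%E.
rewrite law // lee_fin.
have scale y : `|(ln n%:R)^-1 * y - a| = `|y - a * ln n%:R| / ln n%:R.
  rewrite -[X in _ / X](gtr0_norm L0) -normfV -normrM; congr `|_|.
  by field; rewrite gt_eqF.
have cheb := @bernoulli_chebyshev R (p n) _ _ _ n
  (@mallows_pmf_ge0 R (q n) n) (mallows_level_size_gen (q n) n (k n).-1)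
  (a * ln n%:R) (e * ln n%:R) (mulr_gt0 e0 L0).
rewrite (eq_bigl (fun s : 'S_n => e * ln n%:R <= `|(level_size s (k n).-1)%:R - a * ln n%:R|)); last first.
  move=> s; apply/idP/idP; rewrite inE /= scale ler_pdivlMr //.
rewrite (le_trans (cheb _)) //.
  have near_a : `|a - (ln n%:R)^-1 * mean n| <= e / 2.
    by near: n; apply: (cvgr_dist_le _ _ mean_a); rewrite divr_gt0.
  by rewrite (mulrAC e) -ler_pdivrMr // -scale distrC.
rewrite /mean /mean_level -/(p n) le_eqVlt; apply/orP; left; apply/eqP.
by field; rewrite !gt_eqF.
Unshelve. all: by end_near. Qed.

Lemma parking_cvg0 :
  mean n @[n --> \oo] --> (0 : R) ->
  cvg_in_distribution (P := fun n => parking_mallows (q n) n)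
    (fun n => @occurrences R n (k n)) (\d_(0 : R) : probability R R).
Proof.
move=> mean0; apply: cvg_in_distribution_dirac => e e0.
have meanE : (mean n)%:E @[n --> \oo] --> 0%E 
  by apply: cvg_EFin => //; exact: nearW.
apply: (squeeze_cvge _ (cvg_cst 0%E) meanE); near=> n.
have /andP[k0 _] : (0 < k n <= n)%N by near: n.
apply/andP; split; first exact: measure_ge0.
rewrite law // lee_fin.
apply: le_trans (bernoulli_markov (@mallows_pmf_ge0 R (q n) n)
   (mallows_level_size_gen (q n) n (k n).-1)).
rewrite big_mkcond [leRHS]big_mkcond /=; apply: ler_sum => s _.
have pmf0 := mallows_pmf_ge0 (q n) s.
case: ifPn => [|_]; last by case: ifP.
rewrite inE /= subr0 => es; rewrite ifT //; apply: contraTN es => /eqP ->.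
by rewrite normr0 -ltNge.
Unshelve. all: by end_near. Qed.

(** Le Cam compares each point mass with the Poisson weight at the current mean, and continuity in
    the rate moves that mean to [l]. A ray meets only finitely many point masses. *)
Lemma parking_cvg_poisson (l : R) : 0 < l ->
  mean n @[n --> \oo] --> l ->
  \sum_(j < n) p n j ^+ 2 @[n --> \oo] --> (0 : R) ->
  cvg_in_distribution (P := fun n => parking_mallows (q n) n)
    (fun n => @occurrences R n (k n)) (poisson_law l).
Proof.
move=> l0 mean_l p20 x _; have [M xM] := nat_ray x.
rewrite (poisson_law_ray l0 xM).
have coef m : (bernoulli_gen (p n) n)`_m @[n --> \oo] --> poisson_weight m l.
  have wl : poisson_weight m (mean n) @[n --> \oo] --> poisson_weight m l.
    apply: continuous_cvg => //; have [+ _] := is_derive_poisson_weight m l.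
    by move=> /derivable1_diffP /differentiable_continuous.
  have diff0 : (bernoulli_gen (p n) n)`_m - poisson_weight m (mean n) @[n --> \oo] --> (0 : R).
    apply/norm_cvg0P.
    have b0 : 2 * \sum_(j < n) p n j ^+ 2 @[n --> \oo] --> (0 : R).
      by rewrite -[X in _ --> X](mulr0 2); apply: cvgM; [exact: cvg_cst|exact: p20].
    apply: (squeeze_cvgr _ (cvg_cst 0) b0); near=> n; rewrite normr_ge0 /=.
    by apply: bernoulli_gen_poisson => j; exact: success_prob_itv.
  have : (bernoulli_gen (p n) n)`_m - poisson_weight m (mean n) +
      poisson_weight m (mean n) @[n --> \oo] --> 0 + poisson_weight m l.
    exact: cvgD.
  by rewrite add0r; under eq_fun do rewrite subrK.
have : (\sum_(m < M) (bernoulli_gen (p n) n)`_m)%:E @[n --> \oo] -->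
    (\sum_(m < M) poisson_weight m l)%:E.
  apply: cvg_EFin; first exact: nearW.
  by apply: cvg_big => [|m _]; [exact: add_continuous|exact: coef].
apply: cvg_trans; apply: near_eq_cvg; near=> n.
have /andP[k0 _] : (0 < k n <= n)%N by near: n.
apply: etrans (esym (law _ k0)); congr EFin.
rewrite (eq_bigl (fun s : 'S_n => (level_size s (k n).-1 < M)%N)); last first.
  by move=> s; apply/idP/idP; rewrite inE /= in_itv /= xM.
have gen : \sum_(s : 'S_n) mallows_pmf (q n) s *: 'X^(level_size s (k n).-1) =
    bernoulli_gen (p n) n := mallows_level_size_gen (q n) n (k n).-1.
have pmfE (m : 'I_M) : (bernoulli_gen (p n) n)`_m =
    \sum_(s : 'S_n | level_size s (k n).-1 == m) mallows_pmf (q n) s.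
  by rewrite -(@bernoulli_coef R (p n) _ _ _ n gen).
rewrite (eq_bigr _ (fun m _ => pmfE m)).
(* A permutation with level size below [M] is counted for exactly one [m]. *)
rewrite (exchange_big_dep xpredT) //= [RHS]big_mkcond; apply: eq_bigr => s _.
under eq_bigl do rewrite eq_sym.
by rewrite (big_ord1_eq _ (fun=> mallows_pmf (q n) s)).
Unshelve. all: by end_near. Qed.

End parking_limits.

(** * The four regimes of [k n] *)

Theorem theorem6 (R : realType) (q : nat -> {posnum R})
    (q_near1 : (fun n => (q n)%:num - 1) =O_\oo (fun n => n%:R^-1 : R)) :
  [/\
    forall k : nat, (0 < k)%N ->
      cvg_in_distribution (P := fun n => parking_mallows (q n) n)
        (fun n => (ln n%:R)^-1 *: (@occurrences R n k : {mfun _ >-> R}))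
        \d_(1 : R),
    forall (alpha : R) (k : nat -> nat),
      0 < alpha < 1 ->
      (forall n, (0 < n)%N -> (1 <= k n <= n)%N) ->
      (fun n => (k n)%:R : R) =Theta_\oo (fun n => n%:R `^ alpha) ->
      cvg_in_distribution (P := fun n => parking_mallows (q n) n)
        (fun n => (ln n%:R)^-1 *: (@occurrences R n (k n) : {mfun _ >-> R}))
        \d_(1 - alpha),
    forall (c d : R) (k : nat -> nat),
      0 < d < 1 ->
      (\forall n \near \oo, (q n)%:num = 1 + c / n%:R) ->
      (forall n, (0 < n)%N -> (1 <= k n <= n)%N) ->
      (k n)%:R / (d * n%:R) @[n --> \oo] --> (1 : R) ->
      cvg_in_distribution (P := fun n => parking_mallows (q n) n)
        (fun n => @occurrences R n (k n))
        (poisson_law (poisson_rate c d)) &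
    forall k : nat -> nat,
      (forall n, (0 < n)%N -> (1 <= k n <= n)%N) ->
      (fun n => n%:R - (k n)%:R : R) =o_\oo (fun n => n%:R : R) ->
      cvg_in_distribution (P := fun n => parking_mallows (q n) n)
        (fun n => @occurrences R n (k n))
        \d_(0 : R)].
Proof.
have [B qB] := near1_ln_bound q_near1.
have q0 n : 0 < (q n)%:num by [].
split.
- move=> k k0; apply: (@parking_cvg_log R q (fun=> k)).
    by near=> n; rewrite k0 /=; near: n; exact: nbhs_infty_ge.
  have kn : \forall n \near \oo, (k.-1 < n)%N.
    by near=> n; rewrite prednK //; near: n; exact: nbhs_infty_ge.
  (* A fixed [k] is the case of exponent 0, with [ln k] as the bounded error. *)
  have kD : \forall n \near \oo, `|ln k.-1.+1%:R - 0 * ln n%:R| <= `|ln k%:R| :> R.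
    by apply: nearW => n; rewrite prednK // mul0r subr0.
  rewrite -[X in _ --> X]subr0.
  by apply: (mean_level_cvg_log q0 qB kn _ kD); rewrite lexx ltr01.
- move=> alpha k /andP[alpha0 alpha1] k_itv; rewrite eqThetaE => /asboolP.
  move=> [[a b] /= /andP[a0 b0] kab]; apply: (@parking_cvg_log R q k).
    by near=> n; apply: k_itv; near: n; exact: nbhs_infty_gt.
  have kn : \forall n \near \oo, ((k n).-1 < n)%N.
    near=> n; have /k_itv/andP[k0 kn] : (0 < n)%N by near: n; exact: nbhs_infty_gt.
    by rewrite prednK.
  (* [a] and [b] are the two constants of the Theta bound, and taking logarithms makes them additive
     errors. *)
  apply: (mean_level_cvg_log q0 qB kn (D := `|ln a| + `|ln b|)); first by rewrite ltW.
  near=> n; have n0 : (0 < n)%N by near: n; exact: nbhs_infty_gt.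
  have /andP[k0 _] := k_itv n n0; rewrite prednK //.
  have : a * `|n%:R `^ alpha| <= `|(k n)%:R| /\ `|(k n)%:R : R| <= b * `|n%:R `^ alpha|.
    by near: n.
  have P0 : 0 < n%:R `^ alpha :> R by rewrite powR_gt0 // ltr0n.
  rewrite (gtr0_norm P0) normr_nat => -[].
  rewrite -ler_ln ?posrE ?mulr_gt0 ?ltr0n // lnM ?posrE // ln_powR => low.
  rewrite -ler_ln ?posrE ?mulr_gt0 ?ltr0n // lnM ?posrE // ln_powR => high.
  have := ler_norm (ln b); have := normr_ge0 (ln b); have := normr_ge0 (ln a).
  have := ler_norm (- ln a); rewrite normrN ler_norml => *; apply/andP; split; lra.
- move=> c d k d01 q_near k_itv kd.
  have k0 n : (0 < n)%N -> (0 < k n)%N by move=> /k_itv/andP[].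
  have /andP[d0 d1] := d01.
  have kd' : (k n)%:R / n%:R @[n --> \oo] --> d.
    have : d * ((k n)%:R / (d * n%:R)) @[n --> \oo] --> d * 1.
      by apply: cvgM => //; exact: cvg_cst.
    rewrite mulr1; under eq_fun do rewrite invfM mulrCA mulVKf ?gt_eqF //.
    by [].
  have kn : \forall n \near \oo, ((k n).-1 < n)%N.
    near=> n; have /k_itv/andP[k1 kn] : (0 < n)%N by near: n; exact: nbhs_infty_gt.
    by rewrite prednK.
  have k_oo := cvg_window_index k0 d01 kd'.
  have mean_lim : mean_level (fun n => (q n)%:num) (fun n => (k n).-1) n @[n --> \oo] -->
      poisson_rate c d.
    rewrite poisson_rateE; apply: (mean_level_cvg_lnqint q0 qB kn) => //.
    + exact: cvg_window_base q_near.
    + exact: (cvg_window_expr q0 q_near k0 kd').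
    + apply: cvg_trans (cvg_window_lnqint q0 q_near k0 d01 kd').
      apply: near_eq_cvg; near=> n; rewrite prednK //.
      by apply: k0; near: n; exact: nbhs_infty_gt.
  apply: (@parking_cvg_poisson R q k) => //.
  + by near=> n; apply: k_itv; near: n; exact: nbhs_infty_gt.
  + exact: poisson_rate_gt0.
  + exact: (sum_sqr_success_prob_cvg0 q0 qB k_oo mean_lim).
- move=> k k_itv /eqoP nk.
  apply: (@parking_cvg0 R q k).
    by near=> n; apply: k_itv; near: n; exact: nbhs_infty_gt.
  have kn : \forall n \near \oo, ((k n).-1 < n)%N.
    near=> n; have /k_itv/andP[k1 kn] : (0 < n)%N by near: n; exact: nbhs_infty_gt.
    by rewrite prednK.
  apply: (mean_level_cvg0 q0 qB kn).
  have gap0 : (n%:R - (k n)%:R) / n%:R @[n --> \oo] --> (0 : R).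
    apply/cvgrPdist_le => e e0; near=> n.
    have n0 : 0 < n%:R :> R by rewrite ltr0n; near: n; exact: nbhs_infty_gt.
    rewrite sub0r normrN normrM normfV [X in _ / X]gtr0_norm // ler_pdivrMr //.
    have : `|n%:R - (k n)%:R| <= e * `|n%:R| :> R by near: n; exact: nk.
    by rewrite (gtr0_norm n0).
  (* The shifted index makes the numerator [n - k n + 1]; dividing it and [k n] by [n] expresses the
     ratio through the relative gap. *)
  have : ((n%:R - (k n)%:R) / n%:R + n%:R^-1) / (1 - (n%:R - (k n)%:R) / n%:R)
      @[n --> \oo] --> ((0 + 0) / (1 - 0) : R).
    apply: cvgM; first by apply: cvgD => //; exact: cvg_natV.
    apply: cvgV; first by rewrite subr0 oner_neq0.
    by apply: cvgB => //; exact: cvg_cst.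
  rewrite addr0 mul0r; apply: cvg_trans; apply: near_eq_cvg; near=> n.
  have n0 : (0 < n)%N by near: n; exact: nbhs_infty_gt.
  have /andP[k0 kn'] := k_itv n n0.
  rewrite prednK // natrB; last by rewrite (leq_trans (leq_pred _)).
  have -> : (k n).-1%:R = (k n)%:R - 1 :> R by rewrite -[in RHS](prednK k0) -natr1 addrK.
  by field; rewrite !pnatr_eq0 -!lt0n n0 k0.
Unshelve. all: by end_near. Qed.
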